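(* Let $\delta$ be a valley-free range map. The unital associative algebra $(\mathbf{Cl}_\delta,\cdot,\mathds{1})$ admits a finite number of generators and a finite number of nontrivial relations between the generators (i.e. it is finitely presented) if and only if $\delta$ is $1$-dominated.
   Context: $\mathbb{K}$ is a field of characteristic zero, $\mathbb{N}=\{0,1,2,\dots\}$. A range map is a map $\delta:\mathbb{N}\setminus\{0\}\to\mathbb{N}$; it is valley-free if there are no $1\leq i_1<i_2<i_3$ with $\delta(i_1)>\delta(i_2)<\delta(i_3)$, and $1$-dominated if there is $k\geq1$ such that $\delta(1)\geq\delta(k')$ for all $k'\geq k$. A $\delta$-cliff is a finite word $u=u_1\cdots u_n$ of nonnegative integers with $u_i\leq\delta(i)$ for all $i$; $\mathsf{Cl}_\delta$ is the set of all of them, including the empty word $\epsilon$. $\mathbf{Cl}_\delta$ is the $\mathbb{K}$-vector space with basis $\{\mathsf{F}_u:u\in\mathsf{Cl}_\delta\}$. For a word $v\in\mathbb{N}^n$, $\mathrm{r}_\delta(v)_i:=\min\{v_i,\delta(i)\}$. The product is the bilinear map $\mathsf{F}_u\cdot\mathsf{F}_v=\sum_{v'}\mathsf{F}_{uv'}$, summed over all words $v'\in\mathbb{N}^{|v|}$ such that $\mathrm{r}_\delta(v')=v$ and $uv'\in\mathsf{Cl}_\delta$ ($uv'$ is the concatenation). The unit $\mathds{1}:\mathbb{K}\to\mathbf{Cl}_\delta$ sends $1$ to $\mathsf{F}_\epsilon$. For valley-free $\delta$ this is a unital associative algebra. *)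

(* Defs.v *)
From HB Require Import structures.
From mathcomp Require Import all_boot all_order all_algebra finmap.
From mathcomp Require Import monalg.

Set Implicit Arguments.
Unset Strict Implicit.
Unset Printing Implicit Defensive.

Import GRing.Theory.
Local Open Scope ring_scope.

(* A range map, defined on the positive integers, is represented by a function
   delta : nat -> nat; none of the notions below uses the value [delta 0].
   Letters of words are numbered from 1 on paper and from 0 by [nth], so that
   the letter [nth 0 u i] is bounded by [delta i.+1]. *)

Definition valley_free (delta : nat -> nat) : Prop :=
  forall i1 i2 i3 : nat, (1 <= i1)%N -> (i1 < i2)%N -> (i2 < i3)%N ->
    ~ ((delta i1 > delta i2)%N /\ (delta i2 < delta i3)%N).

Definition one_dominated (delta : nat -> nat) : Prop :=
  exists k : nat, (1 <= k)%N /\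
    forall k' : nat, (k <= k')%N -> (delta 1 >= delta k')%N.

Definition is_cliff (delta : nat -> nat) (u : seq nat) : bool :=
  [forall i : 'I_(size u), (nth 0 u i <= delta i.+1)%N].

Definition reduce (delta : nat -> nat) (v : seq nat) : seq nat :=
  mkseq (fun i => minn (nth 0 v i) (delta i.+1)) (size v).

Record cliff (delta : nat -> nat) : predArgType :=
  Cliff { cliff_word :> seq nat; cliffP : is_cliff delta cliff_word }.

HB.instance Definition _ delta := [isSub for @cliff_word delta].
HB.instance Definition _ delta := [Choice of cliff delta by <:].

Lemma is_cliff_nil delta : is_cliff delta [::].
Proof. by apply/forallP => -[]. Qed.

Definition cliff_nil delta : cliff delta := Cliff (is_cliff_nil delta).

Section Words.
Variable delta : nat -> nat.
Implicit Types u v w s : seq nat.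

Lemma is_cliffP u :
  reflect (forall i, (i < size u)%N -> (nth 0 u i <= delta i.+1)%N)
          (is_cliff delta u).
Proof.
apply: (iffP forallP) => [h i hi|h i]; last exact: h.
exact: (h (Ordinal hi)).
Qed.

Lemma size_reduce s : size (reduce delta s) = size s.
Proof. by rewrite size_mkseq. Qed.

Lemma nth_reduce s i : (i < size s)%N ->
  nth 0 (reduce delta s) i = minn (nth 0 s i) (delta i.+1).
Proof. by move=> hi; rewrite nth_mkseq. Qed.

Lemma is_cliff_reduce s : is_cliff delta (reduce delta s).
Proof.
by apply/is_cliffP => i; rewrite size_reduce => hi; rewrite nth_reduce ?geq_minr.
Qed.

Lemma is_cliff_take k s : is_cliff delta s -> is_cliff delta (take k s).
Proof.
move/is_cliffP => h; apply/is_cliffP => i; rewrite size_take_min leq_min.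
by case/andP => hk hs; rewrite nth_take ?h.
Qed.

Lemma reduce_cliff s : is_cliff delta s -> reduce delta s = s.
Proof.
move/is_cliffP => h; apply: (@eq_from_nth _ 0); first by rewrite size_reduce.
move=> i; rewrite size_reduce => hi; rewrite nth_reduce //.
exact/minn_idPl/h.
Qed.

Lemma reduce_take k s : reduce delta (take k s) = take k (reduce delta s).
Proof.
apply: (@eq_from_nth _ 0); first by rewrite size_reduce !size_take size_reduce.
move=> i; rewrite size_reduce => hi; rewrite nth_reduce //.
move: hi; rewrite size_take_min leq_min => /andP[hk hs].
by rewrite !nth_take ?nth_reduce.
Qed.

Lemma reduce_drop (hdelta : valley_free delta) j k w : is_cliff delta w ->
  reduce delta (drop k (reduce delta (drop j w)))
    = reduce delta (drop (j + k) w).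
Proof.
move/is_cliffP => hw; apply: (@eq_from_nth _ 0).
  by rewrite !size_reduce !size_drop size_reduce size_drop subnDA.
move=> i; rewrite size_reduce size_drop size_reduce => hi.
have hki : (k + i < size (drop j w))%N by rewrite -ltn_subRL.
rewrite nth_reduce ?size_drop ?size_reduce // nth_drop nth_reduce //.
move: hki; rewrite size_drop => hki.
rewrite nth_drop nth_reduce; last by rewrite size_drop subnDA ltn_subRL.
rewrite nth_drop !addnA.
have hN : (j + k + i < size w)%N by rewrite -addnA -ltn_subRL.
have := hw _ hN; set x := nth 0 w _ => hx.
case: (leqP (delta i.+1) (delta (k + i).+1)) => [h1|h1].
  by rewrite -minnA (minn_idPr h1).
suff h2 : (x <= delta (k + i).+1)%N by rewrite (minn_idPl h2).
apply: leq_trans hx _; rewrite leqNgt; apply/negP => h2.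
case: k h1 h2 {hi hki hN x} => [|k]; first by rewrite add0n ltnn.
case: j => [|j]; first by rewrite !add0n ltnn.
move=> h1 h2; apply: (hdelta i.+1 (k.+1 + i).+1 (j.+1 + k.+1 + i).+1) => //.
  by rewrite ltnS addSn ltnS leq_addl.
by rewrite ltnS -addnA addSn ltnS leq_addl.
Qed.

End Words.

Section Product.
Variables (K : fieldType) (delta : nat -> nat).

Definition letter_bound (n : nat) : nat := (\max_(i < n) delta i.+1)%N.

(* The words v' of length |v| over the letters 0, ..., B, where B is the maximum
   of delta(1), ..., delta(|u|+|v|), include all those for which u v' is a cliff:
   the summation range is finite without any word of the product being lost.
   The default value of [insubd] is never used, since the sum is restricted to
   the v' such that u v' is a cliff. *)
Definition mul_basis (u v : cliff delta) : {malg K[cliff delta]} :=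
  let B := letter_bound (size u + size v) in
  \sum_(v' : (size v).-tuple 'I_B.+1 |
          (reduce delta (map val v') == v) && is_cliff delta (u ++ map val v'))
     << insubd (cliff_nil delta) (u ++ map val v') >>.

Definition cl_mul (x y : {malg K[cliff delta]}) : {malg K[cliff delta]} :=
  \sum_(u <- msupp x) \sum_(v <- msupp y) (x@_u * y@_v) *: mul_basis u v.

Definition cl_one : {malg K[cliff delta]} := << cliff_nil delta >>.

Definition cl_take (k : nat) (w : cliff delta) : cliff delta :=
  Cliff (is_cliff_take k (cliffP w)).
Definition cl_reduce (s : seq nat) : cliff delta :=
  Cliff (is_cliff_reduce delta s).

Lemma mcoeff_mul_basis (u v w : cliff delta) :
  (mul_basis u v)@_w =
    [&& (size u <= size w)%N, cl_take (size u) w == u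
      & cl_reduce (drop (size u) w) == v]%:R.
Proof.
rewrite /mul_basis raddf_sum /=; set B := letter_bound _.
under eq_bigr => v' /andP[_ hv'].
  rewrite mcoeffU -val_eqE /= insubdK //; over.
case: (boolP [&& _, _ & _]) => [/and3P[hs /eqP/(congr1 val)/= hu]|].
  move=> /eqP/(congr1 val)/= hv.
  have hB x : x \in drop (size u) w -> (x <= B)%N.
    have sv : (size u + size v)%N = size w.
      by rewrite -hv size_reduce size_drop subnKC.
    move=> /mem_drop /(nthP 0)[i hi <-].
    apply: leq_trans (is_cliffP _ _ (cliffP w) _ hi) _.
    rewrite /B /letter_bound sv.
    exact: (@leq_bigmax _ (fun i : 'I_(size w) => delta i.+1) (Ordinal hi)).
  have st : size [seq (inord x : 'I_B.+1) | x <- drop (size u) w] == size v.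
    by rewrite size_map -hv size_reduce.
  have mt : map val (Tuple st) = drop (size u) w.
    rewrite /= -map_comp -[RHS]map_id; apply/eq_in_map => x hx /=.
    by rewrite inordK // ltnS hB.
  have cw : val u ++ drop (size u) w = w.
    by rewrite -[X in X ++ _ = _]hu cat_take_drop.
  rewrite (bigD1 (Tuple st)) /=; last first.
    rewrite -[map _ _]/(map val (Tuple st)) mt hv eqxx /=.
    by rewrite [_ ++ _]cw cliffP.
  rewrite -[map _ _]/(map val (Tuple st)) mt [_ ++ _]cw eqxx big1 ?addr0 //.
  move=> t /andP[_ ht]; case: eqP => // e; case/eqP: ht.
  apply: val_inj; apply: (inj_map val_inj) => /=.
  rewrite -[RHS]/(map val (Tuple st)) mt -e.
  by rewrite drop_size_cat.
move=> hn; rewrite big1 // => t /andP[/eqP ht hc].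
case: eqP => // e; case/negP: hn; rewrite -!val_eqE /= -e.
by rewrite take_size_cat // drop_size_cat // ht size_cat leq_addr !eqxx.
Qed.

Lemma cl_mulU (u v : cliff delta) : cl_mul << u >> << v >> = mul_basis u v.
Proof.
by rewrite /cl_mul !msuppU oner_eq0 !big_seq_fset1 !mcoeffUU mulr1 scale1r.
Qed.

Lemma sum_msupp_delta (x : {malg K[cliff delta]}) (u0 : cliff delta)
    (f : cliff delta -> K) :
  \sum_(u <- msupp x) x@_u * ((u0 == u)%:R * f u) = x@_u0 * f u0.
Proof.
case: (msuppP x u0) => hu; last first.
  rewrite mul0r big_seq big1 // => u hx; case: eqP => [e|_].
    by rewrite e hx in hu.
  by rewrite mul0r mulr0.
rewrite (bigD1_seq u0) ?fset_uniq //= eqxx mul1r big1 ?addr0 // => u hne.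
by rewrite eq_sym (negPf hne) mul0r mulr0.
Qed.

Lemma mcoeff_cl_mul x y (w : cliff delta) :
  (cl_mul x y)@_w =
  \sum_(k < (size w).+1) x@_(cl_take k w) * y@_(cl_reduce (drop k w)).
Proof.
have E u v : (mul_basis u v)@_w = \sum_(k < (size w).+1)
    (cl_take k w == u)%:R * (cl_reduce (drop k w) == v)%:R.
  rewrite mcoeff_mul_basis.
  case: (boolP [&& _, _ & _]) => [/and3P[hs hu hv]|hn].
    rewrite (bigD1 (Ordinal (hs : (size u < (size w).+1)%N))) //= hu hv mul1r.
    rewrite big1 ?addr0 // => k hk; case: eqP => [e|_]; last by rewrite mul0r.
    case/eqP: hk; apply/val_inj => /=.
    by rewrite -e /= size_takel // -ltnS.
  rewrite big1 // => k _; case: eqP => [e|_]; last by rewrite mul0r.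
  rewrite mul1r; case: eqP => // e2; case/negP: hn.
  have -> : size u = k by rewrite -e /= size_takel // -ltnS.
  by rewrite -ltnS ltn_ord e e2 !eqxx.
rewrite /cl_mul raddf_sum /=.
under eq_bigr => u _.
  rewrite raddf_sum /=.
  under eq_bigr => v _ do rewrite mcoeffZ E mulr_sumr.
  rewrite exchange_big /=; over.
rewrite exchange_big /=; apply: eq_bigr => k _.
rewrite -[X in _ * X]mulr1 -(sum_msupp_delta y _ (fun=> 1)).
rewrite -(sum_msupp_delta x _ (fun=> \sum_(v <- msupp y) _)).
apply: eq_bigr => u _; rewrite !mulr_sumr.
by apply: eq_bigr => v _; rewrite mulr1 mulrACA !mulrA.
Qed.

Lemma cl_mulDl : left_distributive cl_mul +%R.
Proof.
move=> x y z; apply/malgP => w; rewrite mcoeffD !mcoeff_cl_mul -big_split.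
by apply: eq_bigr => k _; rewrite mcoeffD mulrDl.
Qed.

Lemma cl_mulDr : right_distributive cl_mul +%R.
Proof.
move=> x y z; apply/malgP => w; rewrite mcoeffD !mcoeff_cl_mul -big_split.
by apply: eq_bigr => k _; rewrite mcoeffD mulrDr.
Qed.

Lemma cl_scaleAl (a : K) x y : a *: cl_mul x y = cl_mul (a *: x) y.
Proof.
apply/malgP => w; rewrite mcoeffZ !mcoeff_cl_mul mulr_sumr.
by apply: eq_bigr => k _; rewrite mcoeffZ mulrA.
Qed.

Lemma cl_scaleAr (a : K) x y : a *: cl_mul x y = cl_mul x (a *: y).
Proof.
apply/malgP => w; rewrite mcoeffZ !mcoeff_cl_mul mulr_sumr.
by apply: eq_bigr => k _; rewrite mcoeffZ mulrCA.
Qed.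

Lemma cl_mul1 : left_id cl_one cl_mul.
Proof.
move=> x; apply/malgP => w; rewrite mcoeff_cl_mul big_ord_recl big1 ?addr0.
  rewrite mcoeffU -val_eqE /= take0 eqxx mul1r; congr (x@_ _).
  by apply: val_inj; rewrite /= drop0 reduce_cliff ?cliffP.
move=> k _; rewrite mcoeffU -val_eqE /=; case: eqP; last by rewrite mul0r.
by move/(congr1 size); rewrite size_takel // ltn_ord.
Qed.

Lemma cl_mulr1 : right_id cl_one cl_mul.
Proof.
move=> x; apply/malgP => w; rewrite mcoeff_cl_mul big_ord_recr big1 /= ?add0r.
  rewrite mcoeffU -val_eqE /= drop_size eqxx mulr1; congr (x@_ _).
  by apply: val_inj; rewrite /= take_size.
move=> k _; rewrite mcoeffU -val_eqE /=; case: eqP; last by rewrite mulr0.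
move/(congr1 size)/esym/eqP; rewrite size_reduce size_drop subn_eq0.
by rewrite leqNgt ltn_ord.
Qed.

Lemma cl_one_neq0 : cl_one != 0.
Proof.
apply/eqP => /(congr1 (mcoeff (cliff_nil delta)))/eqP.
by rewrite mcoeffU eqxx mcoeff0 oner_eq0.
Qed.

Hypothesis hdelta : valley_free delta.

Lemma cl_mulA : associative cl_mul.
Proof.
move=> x y z; apply/malgP => w; rewrite !mcoeff_cl_mul.
pose F j k := x@_(cl_take j w) * y@_(cl_take k (cl_reduce (drop j w)))
  * z@_(cl_reduce (drop (j + k) w)).
transitivity (\sum_(j < (size w).+1) \sum_(k < (size w).+1 | (j + k <= size w)%N)
   F j k).
  apply: eq_bigr => j _; rewrite mcoeff_cl_mul mulr_sumr /= size_reduce size_drop.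
  rewrite (big_ord_widen_cond (size w).+1 predT (fun k => x@_(cl_take j w) *
     (y@_(cl_take k (cl_reduce (drop j w))) *
      z@_(cl_reduce (drop k (reduce delta (drop j w))))))) ?ltnS ?leq_subr //.
  apply: eq_big => [k|k _] /=.
    by rewrite ltnS leq_subRL // -ltnS.
  rewrite /F mulrA; congr (_ * z@_ _); apply: val_inj => /=.
  by rewrite reduce_drop ?cliffP.
transitivity (\sum_(j < (size w).+1) \sum_(i < (size w).+1 | (j <= i)%N)
   F j (i - j)%N).
  apply: eq_bigr => j _.
  have hj : (j <= size w)%N by rewrite -ltnS.
  transitivity (\sum_(j <= i < (size w).+1) F j (i - j)%N); last first.
    by rewrite big_geq_mkord.
  have := @big_addn _ 0 +%R 0 (size w).+1 j predT (fun i => F j (i - j)%N).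
  rewrite add0n => ->; rewrite /= subSn // big_mkord.
  under [RHS]eq_bigr => k _ do rewrite addnK.
  rewrite [RHS](big_ord_widen_cond (size w).+1 predT (F j)) ?ltnS ?leq_subr //.
  by apply: eq_bigl => k /=; rewrite ltnS leq_subRL.
rewrite (exchange_big_dep xpredT) //=; apply: eq_bigr => i _.
have hi : (i <= size w)%N by rewrite -ltnS.
rewrite mcoeff_cl_mul mulr_suml /= size_takel //.
rewrite (big_ord_widen_cond (size w).+1 predT (fun j =>
   x@_(cl_take j (cl_take i w)) * y@_(cl_reduce (drop j (take i w)))
   * z@_(cl_reduce (drop i w)))) ?ltnS //.
apply: eq_big => [j|j hj] //=; rewrite /F subnKC //.
congr (x@_ _ * y@_ _ * _); apply: val_inj => /=.
  by rewrite take_takel.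
by rewrite -reduce_take take_drop subnK.
Qed.

End Product.

(* The valley-freeness proof occurs in the type because the product is
   associative only for valley-free range maps. *)
Definition Cl (K : fieldType) (delta : nat -> nat) (hdelta : valley_free delta)
  : Type := {malg K[cliff delta]}.

Section Algebra.
Variables (K : fieldType) (delta : nat -> nat) (hdelta : valley_free delta).

HB.instance Definition _ := GRing.Lmodule.copy (Cl K hdelta) {malg K[cliff delta]}.

HB.instance Definition _ := GRing.Zmodule_isNzRing.Build (Cl K hdelta)
  (cl_mulA hdelta) (@cl_mul1 K delta) (@cl_mulr1 K delta)
  (@cl_mulDl K delta) (@cl_mulDr K delta) (@cl_one_neq0 K delta).

HB.instance Definition _ := GRing.Lmodule_isLalgebra.Build K (Cl K hdelta)
  (@cl_scaleAl K delta).

HB.instance Definition _ := GRing.Lalgebra_isAlgebra.Build K (Cl K hdelta)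
  (@cl_scaleAr K delta).

End Algebra.

Definition in_two_sided_ideal (A : nzRingType) (rels : seq A) (p : A) : Prop :=
  exists s : seq (A * A * A),
    all (fun t => t.1.2 \in rels) s /\ p = \sum_(t <- s) t.1.1 * t.1.2 * t.2.

(* [{malg K[{fmonom 'I_n}]}] is the free associative unital K-algebra on n
   generators: the monoid algebra of the free monoid on ['I_n]. *)
Definition finitely_presented (K : fieldType) (A : algType K) : Prop :=
  exists (n : nat) (f : {lrmorphism {malg K[{fmonom 'I_n}]} -> A}),
    (forall a : A, exists p, f p = a) /\
    exists rels : seq {malg K[{fmonom 'I_n}]},
      forall p, f p = 0 <-> in_two_sided_ideal rels p.

(* Main.v *)
From HB Require Import structures.
From Stdlib Require Import Classical_Prop.
Require Import Defs.
From mathcomp Require Import all_boot all_order all_algebra finmap.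
From mathcomp Require Import monalg zify.
Set Implicit Arguments.
Unset Strict Implicit.
Unset Printing Implicit Defensive.
Import GRing.Theory.
Local Open Scope ring_scope.

(** In the fundamental basis [F] the product is a sum over a whole interval of
    words, but it becomes a concatenation after a triangular change of basis.
    For a word [s], let [E_s] be the sum of all [F_w] such that [w] is a cliff
    of the same length with [s <= w] letter by letter.  Truncating the letters
    of a suffix to their bounds does not affect whether they dominate the
    letters of a cliff, so [E_s * E_t = E_(st)] for every cliff [t], where
    [E_(st) = 0] as soon as [st] is not a cliff ([upsum_mul]).  The [E_u], for
    [u] a cliff, form a basis ([upsum_lin_inj], [upsum_lin_surj]), so that the
    algebra is that of a monoid with zero: the cliffs, under concatenation when
    it yields a cliff.

    If the algebra is finitely generated, then the indecomposable cliffs, those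
    that are not a product of two nonempty cliffs, have bounded length: the
    coefficient on [E_w], for [w] indecomposable, is a derivation relative to
    the coefficient on [1], so it vanishes on everything generated by elements
    on which it vanishes ([indecomposable_bound]).  If [delta] exceeds
    [delta 1] at arbitrarily large places, there are arbitrarily long
    indecomposable cliffs ([long_indecomposable]): let [p] be the first place
    where [delta p > delta 1]; valley-freeness keeps [delta] above [delta 1]
    between [p] and any later such place, so [p - 1] zeros followed by many
    letters [delta 1 + 1] form a cliff; and every proper suffix of it is cut off
    so that one of the large letters lands at a place whose bound is at most
    [delta 1].

    If [delta] is 1-dominated, it is eventually constant, at a value which is at
    most [delta 1] ([one_dominated_stable]), say from place [L] on.  Each letter
    of a cliff after the first [L] letters is then a one-letter cliff, and
    whether it may be appended to a word does not depend on the length of this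
    word.  So [E_w] is the product of [E_u], with [u] the prefix of length [L],
    and of one-letter elements; this factorization is taken as a normal form in
    the free algebra on the cliffs of length at most [L].  Equating each product
    of two generators with its normal form gives finitely many relations, and
    they suffice to reduce any monomial, multiplying by one generator at a time
    ([normal_form_mul_gen]). *)

(** * Linear maps on free modules *)

Section LinearExtension.
Variables (K : fieldType) (I : choiceType) (V : lmodType K) (g : I -> V).
Implicit Types x y : {malg K[I]}.

Definition linear_extension x : V := \sum_(i <- msupp x) x@_i *: g i.

Lemma linear_extensionEw (d : {fset I}) x : {subset msupp x <= d} ->
  linear_extension x = \sum_(i <- d) x@_i *: g i.
Proof.
move=> hd; rewrite /linear_extension (big_fset_incl _ (B := d)) //.
  exact/fsubsetP.
by move=> i _ /mcoeff_outdom ->; rewrite scale0r.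
Qed.

Lemma linear_extensionU i : linear_extension << i >> = g i.
Proof.
by rewrite /linear_extension msuppU oner_eq0 big_seq_fset1 mcoeffUU scale1r.
Qed.

Fact linear_extension_is_linear : linear linear_extension.
Proof.
move=> a x y; pose d := (msupp x `|` msupp y)%fset.
have hx : {subset msupp x <= d} by move=> i; rewrite in_fsetU => ->.
have hy : {subset msupp y <= d} by move=> i; rewrite in_fsetU orbC => ->.
rewrite (linear_extensionEw hx) (linear_extensionEw hy).
rewrite (linear_extensionEw (d := d)) => [|i].
  rewrite scaler_sumr -big_split /=; apply: eq_bigr => i _.
  by rewrite mcoeffD mcoeffZ scalerDl scalerA.
rewrite -mcoeff_neq0 mcoeffD mcoeffZ; apply: contraR.
rewrite in_fsetU negb_or => /andP[/mcoeff_outdom -> /mcoeff_outdom ->].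
by rewrite mulr0 addr0.
Qed.

HB.instance Definition _ :=
  GRing.isLinear.Build K {malg K[I]} V *:%R linear_extension
    linear_extension_is_linear.

End LinearExtension.

Lemma malg_span (K : fieldType) (I : choiceType) (x : {malg K[I]}) :
  x = \sum_(i <- msupp x) x@_i *: << i >>.
Proof.
rewrite [LHS]monalgE; apply: eq_bigr => i _; apply/malgP => j.
by rewrite mcoeffZ !mcoeffU mulr_natr.
Qed.

(** * Letterwise comparison of words *)
Section Words.
Implicit Types s t u v w : seq nat.

Definition le_word s w := all2 leq s w.

Lemma le_wordP s w :
  reflect (size s = size w /\
    forall i, (i < size w)%N -> (nth 0 s i <= nth 0 w i)%N) (le_word s w).
Proof.
rewrite /le_word; elim: s w => [|a s IHs] [|b w] /=; try by right => -[].
  by left; split.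
apply: (iffP andP) => [[hab /IHs [hsz h]]|[/eq_add_S hsz h]].
  by split=> [|[|i] //]; [rewrite hsz | apply: h].
split; first exact: (h 0).
by apply/IHs; split=> // i hi; apply: (h i.+1).
Qed.

Lemma le_word_size s w : le_word s w -> size s = size w.
Proof. by case/le_wordP. Qed.

Lemma le_word_refl s : le_word s s.
Proof. by apply/le_wordP; split. Qed.

(** Comparable words are ordered strictly by the sum of their letters, which
    serves as the rank in both triangularity arguments below. *)
Lemma le_word_sumn s w : le_word s w -> (sumn s <= sumn w ?= iff (s == w))%N.
Proof.
elim: s w => [|a s IHs] [|b w] //= /andP[hab /IHs hsw].
by rewrite eqseq_cons; apply: leqif_add => //; apply/leqif_eq.
Qed.

Lemma le_word_cat u v w : le_word (u ++ v) w =
  le_word u (take (size u) w) && le_word v (drop (size u) w).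
Proof.
by elim: u w => [|a u IHu] [|b w]; rewrite /le_word //= -andbA; congr (_ && _);
  apply: IHu.
Qed.

Lemma le_word_cliff delta s w : le_word s w -> is_cliff delta w ->
  is_cliff delta s.
Proof.
case/le_wordP=> hsz hle /is_cliffP hw; apply/is_cliffP => i hi.
by rewrite hsz in hi; apply: leq_trans (hle _ hi) (hw _ hi).
Qed.

(** The letters of a cliff are already below the bounds used in the truncation,
    so truncating the larger word cannot destroy the comparison.  This is what
    turns the product into a concatenation. *)
Lemma le_word_reduce delta v w : is_cliff delta v ->
  le_word v (reduce delta w) = le_word v w.
Proof.
move/is_cliffP => hv; apply/le_wordP/le_wordP => -[hsz hle];
  rewrite size_reduce in hsz hle *; split=> // i hi.
  by move/(_ i hi): hle; rewrite nth_reduce // leq_min => /andP[].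
by rewrite nth_reduce // leq_min hle // hv // hsz.
Qed.

Lemma is_cliff_rcons delta w b :
  is_cliff delta (rcons w b) = is_cliff delta w && (b <= delta (size w).+1)%N.
Proof.
apply/is_cliffP/andP => [h|[/is_cliffP h hb] i].
  split; last first.
    by move: (h (size w)); rewrite nth_rcons ltnn eqxx size_rcons; apply.
  apply/is_cliffP => i hi; move: (h i); rewrite nth_rcons hi size_rcons.
  by apply; apply: ltnW.
by rewrite size_rcons ltnS leq_eqVlt nth_rcons => /orP[/eqP-> | hi];
  rewrite ?ltnn ?eqxx ?hi ?h.
Qed.

Fixpoint cliff_words (delta : nat -> nat) (n : nat) : seq (seq nat) :=
  if n is m.+1
  then [seq rcons w a | w <- cliff_words delta m, a <- iota 0 (delta n).+1]
  else [:: [::]].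

Lemma mem_cliff_words delta n w :
  (w \in cliff_words delta n) = (size w == n) && is_cliff delta w.
Proof.
elim: n w => [|n IHn] w.
  rewrite inE; case: w => [|a w] //=.
  by rewrite is_cliff_nil.
apply/allpairsP/andP => [[[u a] [hu ha ->]]|[]].
  move: hu ha; rewrite IHn mem_iota add0n /= ltnS => /andP[/eqP hsz hu] ha.
  by rewrite size_rcons hsz is_cliff_rcons hu hsz.
case/lastP: w => [|u a] //; rewrite size_rcons eqSS is_cliff_rcons.
move=> /eqP hsz /andP[hu]; rewrite hsz => ha.
by exists (u, a); split; rewrite ?mem_iota ?add0n ?ltnS // IHn hsz eqxx.
Qed.

Lemma uniq_cliff_words delta n : uniq (cliff_words delta n).
Proof.
elim: n => [//|n IHn]; apply: allpairs_uniq => //; first exact: iota_uniq.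
by move=> [u a] [v b] _ _ /= /rcons_inj.
Qed.

End Words.

(** * The basis of upper sums *)
Section UpperSums.
Variables (K : fieldType) (delta : nat -> nat) (hdelta : valley_free delta).
Local Notation A := (Cl K hdelta).
Implicit Types (u v w : cliff delta) (s t : seq nat).

(** Defined for all words, and not only for cliffs, so that the product rule
    below needs no case distinction on whether a concatenation is a cliff. *)
Definition upsum s : A :=
  \sum_(w <- pmap insub (cliff_words delta (size s))
        | le_word s (w : cliff delta)) (<< w >> : {malg K[cliff delta]}).

Lemma mcoeff_upsum s w :
  (upsum s : {malg K[cliff delta]})@_w = (le_word s w)%:R.
Proof.
rewrite /upsum raddf_sum /=.
under eq_bigr do rewrite mcoeffU.
case: (boolP (le_word s w)) => hs; last first.
  rewrite big1 // => u hu; case: eqP => // e; by rewrite -e hu in hs.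
have hw : w \in pmap insub (cliff_words delta (size s)).
  by rewrite mem_pmap_sub mem_cliff_words (le_word_size hs) eqxx (cliffP w).
rewrite big_mkcond (bigD1_seq w) ?pmap_sub_uniq ?uniq_cliff_words //=.
rewrite hs eqxx big1 ?addr0 // => u /negPf ->.
by case: ifP.
Qed.

Lemma upsum_not_cliff s : ~~ is_cliff delta s -> upsum s = 0.
Proof.
move=> hs; apply/malgP => w; rewrite mcoeff_upsum mcoeff0.
case: (boolP (le_word s w)) => // hw.
by rewrite (le_word_cliff hw (cliffP w)) in hs.
Qed.

Lemma upsum_nil : upsum [::] = 1.
Proof.
apply/malgP => w; rewrite mcoeff_upsum [RHS]mcoeffU -val_eqE /=.
by case: (val w).
Qed.

(** In the coefficient of [w], only the cut of [w] after [size s] letters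
    contributes.  When [s ++ t] is not a cliff both sides vanish. *)
Lemma upsum_mul s t : is_cliff delta t -> upsum s * upsum t = upsum (s ++ t).
Proof.
move=> ht; apply/malgP => w; rewrite [LHS]mcoeff_cl_mul mcoeff_upsum.
under eq_bigr do rewrite !mcoeff_upsum /= le_word_reduce //.
rewrite le_word_cat; case: (leqP (size s) (size w)) => hsw.
  rewrite -ltnS in hsw; rewrite (bigD1 (Ordinal hsw)) //= -natrM mulnb.
  rewrite big1 ?addr0 // => k hk; case: (boolP (le_word s _)) => [h|_].
    case/eqP: hk; apply/val_inj => /=; rewrite (le_word_size h) size_takel //.
    by rewrite -ltnS.
  by rewrite mul0r.
have no k : le_word s (take k w) = false.
  apply/negP => /le_word_size hsz; move: hsw.
  by rewrite hsz size_take_min ltnNge geq_minr.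
by rewrite no big1 // => k _; rewrite no mul0r.
Qed.

Definition upsum_lin : {malg K[cliff delta]} -> A :=
  linear_extension (fun u : cliff delta => upsum u).
HB.instance Definition _ := GRing.Linear.on upsum_lin.

(** Triangularity: in a vanishing combination of upper sums, a cliff [u] of
    least sum of letters lies above no other cliff of the support, so the
    coefficient of [F_u] is the coefficient of [upsum u]. *)
Lemma upsum_lin_inj : injective upsum_lin.
Proof.
move=> x y /eqP; rewrite -subr_eq0 -raddfB => /eqP; set z := x - y => hz.
apply/eqP; rewrite -subr_eq0 -/z; apply/negPn/negP => nz.
have [u hu min_u] : exists2 u, u \in msupp z &
    forall v, v \in msupp z -> (sumn u <= sumn v)%N.
  have : exists n, [exists u : msupp z, sumn (val u) == n].
    have /fset0Pn[u hu] : msupp z != fset0.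
      apply: contra nz => /eqP z0; apply/eqP/malgP => w.
      by rewrite mcoeff0 mcoeff_outdom // z0.
    by exists (sumn u); apply/existsP; exists [` hu]%fset.
  case/ex_minnP => n /existsP[u /eqP hu] hmin.
  exists (val u); first exact: valP.
  move=> v hv; rewrite hu; apply: hmin; apply/existsP.
  by exists [` hv]%fset.
have sum0 : \sum_(i <- msupp z) z@_i *: upsum i = 0 by exact: hz.
have := congr1 (fun a : {malg K[cliff delta]} => a@_u) sum0.
rewrite mcoeff0 raddf_sum /=.
under eq_bigr do rewrite mcoeffZ mcoeff_upsum.
rewrite (bigD1_seq u) //= le_word_refl mulr1 big_seq_cond big1 ?addr0.
  by move/eqP; rewrite mcoeff_eq0 hu.
move=> v /andP[hv nvu]; case: (boolP (le_word v u)) => [le_vu|_]; last first.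
  by rewrite mulr0.
case/negP: nvu; rewrite -val_eqE -(geq_leqif (le_word_sumn le_vu)).
exact: min_u.
Qed.

(** [F_u] is [upsum u] minus the [F_w] with [w] strictly above [u]; the
    induction is on how far the sum of the letters of [u] is from its maximum
    among cliffs of the same length. *)
Lemma upsum_lin_surj (a : A) : exists x, upsum_lin x = a.
Proof.
pose im (b : A) := exists x, upsum_lin x = b.
have im0 : im 0 by exists 0; rewrite raddf0.
have imD b c : im b -> im c -> im (b + c).
  by move=> [x <-] [y <-]; exists (x + y); rewrite raddfD.
have imZ k b : im b -> im (k *: b).
  by move=> [x <-]; exists (k *: x); rewrite linearZ.
suff basis u : im (<< u >> : {malg K[cliff delta]}).
  rewrite -/(im a) (malg_span (a : {malg K[cliff delta]})).
  by apply: big_ind => // u _; apply: imZ.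
pose top (s : seq nat) := sumn (mkseq (fun i => delta i.+1) (size s)).
have le_top (w : cliff delta) : (sumn w <= top w)%N.
  have /le_word_sumn[] // : le_word w (mkseq (fun i => delta i.+1) (size w)).
  apply/le_wordP; rewrite size_mkseq; split=> // i hi.
  by rewrite nth_mkseq // (is_cliffP _ _ (cliffP w)).
have [n hn] : exists n, (top u - sumn u < n)%N by exists (top u - sumn u).+1%N.
elim: n u hn => [//|n IHn] u hn.
have -> : (<< u >> : {malg K[cliff delta]}) = upsum u + -1 *:
    \sum_(w <- pmap insub (cliff_words delta (size u))
          | le_word u (w : cliff delta) && (w != u)) << w >>.
  rewrite /upsum big_mkcond (bigD1_seq u) ?pmap_sub_uniq ?uniq_cliff_words //=.
    by rewrite le_word_refl -big_mkcondl scaleN1r addrK.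
  by rewrite mem_pmap_sub mem_cliff_words eqxx (cliffP u).
apply/imD; first by exists << u >>; rewrite /upsum_lin linear_extensionU.
apply: imZ; apply: (big_ind im) => // w /andP[le_uw nwu]; apply: IHn.
have lt_uw : (sumn u < sumn w)%N.
  by rewrite (ltn_leqif (le_word_sumn le_uw)) eq_sym val_eqE.
have top_uw : top u = top w by rewrite /top (le_word_size le_uw).
rewrite ltnS in hn; apply: leq_trans hn; rewrite top_uw.
by apply: ltn_sub2l => //; apply: leq_trans lt_uw (le_top w).
Qed.

(** Opaque, so that comparing coordinates never unfolds the choice of a
    preimage. *)
Fact upsum_lin_inverse : {c : A -> {malg K[cliff delta]} | cancel c upsum_lin}.
Proof.
have pre a : exists x, upsum_lin x == a.
  by have [x <-] := upsum_lin_surj a; exists x.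
by exists (fun a => xchoose (pre a)) => a; apply/eqP/(xchooseP (pre a)).
Qed.

Definition upsum_coord : A -> {malg K[cliff delta]} := sval upsum_lin_inverse.

Lemma upsum_coordK : cancel upsum_coord upsum_lin.
Proof. exact: svalP upsum_lin_inverse. Qed.

Lemma upsum_linK : cancel upsum_lin upsum_coord.
Proof. by move=> x; apply: upsum_lin_inj; rewrite upsum_coordK. Qed.

HB.instance Definition _ :=
  GRing.isLinear.Build K A {malg K[cliff delta]} *:%R upsum_coord
    (can2_linear upsum_linK upsum_coordK).

Lemma upsum_coord_cliff u : upsum_coord (upsum u) = << u >>.
Proof.
by apply: upsum_lin_inj; rewrite upsum_coordK /upsum_lin linear_extensionU.
Qed.

Lemma mcoeff_upsum_coord s w : (upsum_coord (upsum s))@_w = (s == w)%:R.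
Proof.
case: (boolP (is_cliff delta s)) => hs.
  by rewrite (upsum_coord_cliff (Cliff hs)) mcoeffU -val_eqE.
rewrite (upsum_not_cliff hs) raddf0 mcoeff0; case: eqP => // e.
by rewrite e (cliffP w) in hs.
Qed.

Lemma upsum_span (a : A) :
  a = \sum_(u <- msupp (upsum_coord a)) (upsum_coord a)@_u *: upsum u.
Proof. by rewrite -{1}[a]upsum_coordK. Qed.

Lemma eq_linear_upsum (V : lmodType K) (f h : {linear A -> V}) :
  (forall u, f (upsum u) = h (upsum u)) -> f =1 h.
Proof.
move=> fh a; rewrite (upsum_span a) !linear_sum; apply: eq_bigr => u _.
by rewrite !linearZ_LR fh.
Qed.

(** Only the suffix is required to be a cliff: a prefix of a cliff always is. *)
Definition indecomposable w :=
  forall s t, is_cliff delta t -> s ++ t = w -> s = [::] \/ t = [::].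

(** The coefficient on [upsum w] is a derivation relative to the coefficient on
    the unit, since the only factorizations of [w] are the two trivial ones. *)
Lemma upsum_coord_mul w a b : (w : seq nat) != [::] -> indecomposable w ->
  (upsum_coord (a * b))@_w =
    (upsum_coord a)@_(cliff_nil delta) * (upsum_coord b)@_w
    + (upsum_coord a)@_w * (upsum_coord b)@_(cliff_nil delta).
Proof.
move=> nw indw; set ca := upsum_coord a; set cb := upsum_coord b.
have -> : a * b = \sum_(u <- msupp ca) \sum_(v <- msupp cb)
    (ca@_u * cb@_v) *: upsum (u ++ v).
  rewrite {1}(upsum_span a) {1}(upsum_span b) mulr_suml; apply: eq_bigr => u _.
  rewrite mulr_sumr; apply: eq_bigr => v _.
  by rewrite -scalerAl -scalerAr scalerA upsum_mul ?cliffP.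
have split_w u v : (val u ++ val v == w)%:R =
    (cliff_nil delta == u)%:R * ((w == v)%:R * 1)
    + (w == u)%:R * ((cliff_nil delta == v)%:R * 1) :> K.
  rewrite !mulr1 -!natrM -natrD !mulnb -!val_eqE /=.
  case: (eqVneq [::] (val u)) => [<-|nu] /=.
    by rewrite (negPf nw) eq_sym addn0.
  case: (eqVneq [::] (val v)) => [<-|nv]; first by rewrite cats0 andbT eq_sym.
  rewrite andbF; case: eqP => // /indw [|u0|v0]; first exact: cliffP.
    by rewrite /= u0 in nu.
  by rewrite /= v0 in nv.
have pick u : \sum_(v <- msupp cb) cb@_v * ((u == v)%:R * 1) = cb@_u.
  by rewrite sum_msupp_delta mulr1.
rewrite -(sum_msupp_delta ca (cliff_nil delta) (fun=> cb@_w)).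
rewrite -(sum_msupp_delta ca w (fun=> cb@_(cliff_nil delta))) -big_split /=.
rewrite !raddf_sum; apply: eq_bigr => u _.
rewrite -(pick w) -(pick (cliff_nil _)).
rewrite !raddf_sum !mulr_sumr -big_split /=; apply: eq_bigr => v _.
rewrite linearZ_LR mcoeffZ mcoeff_upsum_coord split_w mulrDr.
by congr (_ + _); rewrite -!mulrA; congr (_ * _); rewrite mulrCA.
Qed.

Lemma upsum_coord_mul_eq0 w a b : (w : seq nat) != [::] -> indecomposable w ->
  (upsum_coord a)@_w = 0 -> (upsum_coord b)@_w = 0 ->
  (upsum_coord (a * b))@_w = 0.
Proof.
by move=> nw indw ha hb; rewrite upsum_coord_mul // ha hb mulr0 mul0r addr0.
Qed.

End UpperSums.

(** * Finite presentations *)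
Section FreeMorphism.
Variables (K : fieldType) (n : nat).
Local Notation free := {malg K[{fmonom 'I_n}]}.

Definition free_gen (i : 'I_n) : free := << fmu i >>.

Lemma free_ind (P : free -> Prop) :
  P 1 -> (forall p i, P p -> P (p * free_gen i)) ->
  (forall p q, P p -> P q -> P (p + q)) -> (forall c p, P p -> P (c *: p)) ->
  forall p, P p.
Proof.
move=> P1 Pgen PD PZ p.
have P0 : P 0 by rewrite -(scale0r 1); apply/PZ.
rewrite (malg_span p); apply: (big_ind P) => // -[m] _; apply: PZ.
elim/last_ind: m => [|m i IHm].
  rewrite -fmoneE; exact: P1.
have -> : << FMonom (rcons m i) >> = << FMonom m >> * free_gen i :> free.
  rewrite malgM_def fgmulUU mulr1; congr << _ *g _ >>.
  by apply/eqP; rewrite fmP fmM fmU cats1.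
exact: Pgen.
Qed.

Variables (A : algType K) (g : 'I_n -> A).

Definition word_eval (m : {fmonom 'I_n}) : A := \prod_(i <- m) g i.

Fact word_eval_mmorphism : mmorphism word_eval.
Proof.
by split=> [m1 m2|]; rewrite /word_eval ?fm1 ?big_nil // fmM big_cat.
Qed.
HB.instance Definition _ :=
  isMultiplicative.Build {fmonom 'I_n} A word_eval word_eval_mmorphism.

Definition free_eval : free -> A := mmap (in_alg A) word_eval.
HB.instance Definition _ := GRing.Additive.on free_eval.

Fact free_eval_monoid_morphism : monoid_morphism free_eval.
Proof.
have comm (p : free) m m' : GRing.comm (in_alg A p@_m) (word_eval m').
  by rewrite /GRing.comm /= mulr_algl mulr_algr.
by case: (commr_mmap_is_multiplicative comm).
Qed.
HB.instance Definition _ :=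
  GRing.isMonoidMorphism.Build free A free_eval free_eval_monoid_morphism.

Fact free_eval_is_scalable : scalable free_eval.
Proof. by move=> c p; rewrite /free_eval mmapZ /= mulr_algl. Qed.
HB.instance Definition _ :=
  GRing.isScalable.Build K free A *:%R free_eval free_eval_is_scalable.

Lemma free_evalU i : free_eval (free_gen i) = g i.
Proof.
by rewrite /free_eval /free_gen mmapU /= scale1r mul1r /word_eval fmU big_seq1.
Qed.

End FreeMorphism.

Section Ideals.
Variables (A : nzRingType) (rels : seq A).
Local Notation ideal := (in_two_sided_ideal rels).

Lemma ideal0 : ideal 0.
Proof. by exists [::]; rewrite big_nil. Qed.

Lemma idealD p q : ideal p -> ideal q -> ideal (p + q).
Proof.
move=> [s [hs ->]] [t [ht ->]]; exists (s ++ t).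
by rewrite all_cat hs ht big_cat.
Qed.

Lemma idealMl r p : ideal p -> ideal (r * p).
Proof.
move=> [s [hs ->]]; exists [seq (r * t.1.1, t.1.2, t.2) | t <- s].
rewrite all_map; split; first exact: hs.
by rewrite big_map mulr_sumr; apply: eq_bigr => t _ /=; rewrite !mulrA.
Qed.

Lemma idealMr r p : ideal p -> ideal (p * r).
Proof.
move=> [s [hs ->]]; exists [seq (t.1.1, t.1.2, t.2 * r) | t <- s].
rewrite all_map; split; first exact: hs.
by rewrite big_map mulr_suml; apply: eq_bigr => t _ /=; rewrite !mulrA.
Qed.

Lemma ideal_rel p : p \in rels -> ideal p.
Proof.
by move=> hp; exists [:: (1, p, 1)]; rewrite /= hp big_seq1 mul1r mulr1.
Qed.

Lemma ideal_trans q p r : ideal (p - q) -> ideal (q - r) -> ideal (p - r).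
Proof. by move=> hpq /(idealD hpq); rewrite addrA subrK. Qed.

Lemma ideal_kernel (B : nzRingType) (f : {rmorphism A -> B}) p :
  (forall q, q \in rels -> f q = 0) -> ideal p -> f p = 0.
Proof.
move=> hf [s [/allP hs ->]]; rewrite rmorph_sum big_seq big1 // => t /hs ht.
by rewrite !rmorphM (hf _ ht) mulr0 mul0r.
Qed.

End Ideals.

(** If a linear section [sec] of the evaluation [f] preserves [1] and commutes
    with right multiplication by the generators modulo the ideal, every [p] is
    congruent to [sec (f p)], by induction on monomials; hence the ideal
    contains the whole kernel. *)
Lemma finitely_presented_by_lift (K : fieldType) (A : algType K) (n : nat)
    (g : 'I_n -> A) (sec : {linear A -> {malg K[{fmonom 'I_n}]}})
    (rels : seq {malg K[{fmonom 'I_n}]}) :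
  (forall a, free_eval g (sec a) = a) ->
  (forall q, q \in rels -> free_eval g q = 0) ->
  in_two_sided_ideal rels (1 - sec 1) ->
  (forall a i,
     in_two_sided_ideal rels (sec a * free_gen K i - sec (a * g i))) ->
  finitely_presented A.
Proof.
move=> secK rels0 sec1 secM; exists n, (free_eval g); split.
  by move=> a; exists (sec a); exact: secK.
exists rels => p; split; last exact: ideal_kernel.
suff: in_two_sided_ideal rels (p - sec (free_eval g p)).
  by move=> h fp0; rewrite fp0 raddf0 subr0 in h.
elim/free_ind: p => [|p i IHp|p q IHp IHq|c p IHp].
- by rewrite rmorph1.
- apply: (ideal_trans (q := sec (free_eval g p) * free_gen K i)).
    by rewrite -mulrBl; apply: idealMr.
  by rewrite rmorphM /= free_evalU.
- by rewrite !raddfD addrACA; apply: idealD.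
by rewrite !linearZ_LR -scalerDr -mulr_algl; apply: idealMl.
Qed.

(** * Finite generation bounds the indecomposable cliffs *)
Section Finiteness.
Variables (K : fieldType) (delta : nat -> nat) (hdelta : valley_free delta).
Local Notation A := (Cl K hdelta).
Local Notation E := (upsum K hdelta).

(** The supports of the finitely many generators contain cliffs of bounded
    length only; for a longer indecomposable [w], the coefficient on [upsum w]
    vanishes on the generators, hence on the whole image, although it is [1] on
    [upsum w] itself. *)
Lemma indecomposable_bound (n : nat)
    (f : {lrmorphism {malg K[{fmonom 'I_n}]} -> A}) :
  (forall a, exists p, f p = a) ->
  exists N, forall w : cliff delta, indecomposable w -> (size w <= N)%N.
Proof.
move=> f_surj; pose N := (\max_(i < n)
  \max_(w <- msupp (upsum_coord (f (free_gen K i)))) size (w : cliff delta))%N.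
exists N => w indw; rewrite leqNgt; apply/negP => hw.
have nw : (w : seq nat) != [::] by case: (val w) hw.
have coord_gen i : (upsum_coord (f (free_gen K i)))@_w = 0.
  apply/eqP; rewrite mcoeff_eq0; apply: contraL hw => hw; rewrite -leqNgt.
  apply: leq_trans (leq_bigmax i); exact: (leq_bigmax_seq _ hw).
have [p fp] := f_surj (E w).
have /eqP : (upsum_coord (f p))@_w = 1 by rewrite fp mcoeff_upsum_coord eqxx.
suff -> : (upsum_coord (f p))@_w = 0 by rewrite eq_sym oner_eq0.
elim/free_ind: p {fp} => [|p i IHp|p q IHp IHq|c p IHp].
- by rewrite rmorph1 -upsum_nil mcoeff_upsum_coord eq_sym (negPf nw).
- rewrite rmorphM; exact: (upsum_coord_mul_eq0 nw indw IHp (coord_gen i)).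
- rewrite (raddfD f) (raddfD (@upsum_coord K delta hdelta)) mcoeffD.
  by rewrite IHp IHq addr0.
rewrite (linearZ_LR f) (linearZ_LR (@upsum_coord K delta hdelta)) mcoeffZ.
by rewrite IHp mulr0.
Qed.

End Finiteness.

(** With [p] the first place where [delta] exceeds [delta 1], the cliff is made
    of [p - 1] zeros and [m - p + 1] letters [delta 1 + 1].  In a suffix that
    starts within the zeros, the first large letter moves to a place before
    [p]; in a later suffix, the first letter is large.  Both places have bound
    at most [delta 1]. *)
Lemma long_indecomposable delta m : valley_free delta -> (1 < m)%N ->
  (delta 1 < delta m)%N ->
  exists2 w : cliff delta, size w = m & indecomposable w.
Proof.
move=> hdelta m_gt1 delta_m; set a := delta 1 in delta_m.
have ex_p : exists p, (0 < p)%N && (a < delta p)%N.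
  by exists m; rewrite delta_m ltnW.
case: (ex_minnP ex_p) => p /andP[p_gt0 delta_p] min_p.
have le_pm : (p <= m)%N by apply: min_p; rewrite delta_m ltnW.
have delta_lt j : (0 < j < p)%N -> (delta j <= a)%N.
  case/andP=> j_gt0; rewrite ltnNge; apply: contraR; rewrite -ltnNge => h.
  by apply: min_p; rewrite j_gt0.
have delta_ge j : (p <= j <= m)%N -> (a < delta j)%N.
  case/andP; rewrite leq_eqVlt => /orP[/eqP <- //|lt_pj].
  rewrite leq_eqVlt => /orP[/eqP -> //|lt_jm].
  rewrite ltnNge; apply/negP => h; apply: (hdelta p j m) => //.
  by split; apply: leq_ltn_trans h _.
pose w := mkseq (fun i => if (i.+1 < p)%N then 0%N else a.+1) m.
have cliff_w : is_cliff delta w.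
  apply/is_cliffP => i; rewrite size_mkseq => hi; rewrite nth_mkseq //.
  case: ltnP => // hp; apply: delta_ge; exact/andP.
exists (Cliff cliff_w); first by rewrite size_mkseq.
move=> s t /is_cliffP ht /= def_w.
case: (posnP (size s)) => [/size0nil|s_gt0]; [by left | right].
apply/nilP; rewrite /nilp eqn0Ngt; apply/negP => t_gt0.
have size_st : (size s + size t)%N = m by rewrite -size_cat def_w size_mkseq.
(* With letters counted from 0, [i] is the place in the suffix [t] of its first
   large letter; the truncated subtraction covers the suffixes that start after
   the zeros, for which [i = 0]. *)
pose i := (p.-1 - size s)%N.
have lt_i : (i < size t)%N by rewrite /i; lia.
have := ht i lt_i.
have <- : nth 0%N w (size s + i) = nth 0%N t i.
  by rewrite -def_w nth_cat ltnNge leq_addr addKn.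
rewrite nth_mkseq; last by rewrite -size_st ltn_add2l.
have -> : ((size s + i).+1 < p)%N = false by apply/negbTE; rewrite /i; lia.
apply/negP; rewrite -ltnNge ltnS.
case: (posnP i) => [-> //|i_gt0]; apply: delta_lt; rewrite /i in i_gt0 *; lia.
Qed.

(** * Stabilization of 1-dominated range maps *)
Lemma exists_argmin (P : nat -> Prop) (f : nat -> nat) : (exists i, P i) ->
  exists2 i, P i & forall j, P j -> (f i <= f j)%N.
Proof.
move=> [i Pi]; have [n le_n] : exists n, (f i <= n)%N by exists (f i).
elim: n i Pi le_n => [|n IHn] i Pi le_n.
  by exists i => // j _; apply: leq_trans le_n (leq0n _).
have [[j Pj lt_j]|no_j] := classic (exists2 j, P j & (f j < f i)%N).
  by apply: (IHn j) => //; rewrite -ltnS (leq_trans lt_j).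
exists i => // j Pj; rewrite leqNgt; apply/negP => lt_j.
by apply: no_j; exists j.
Qed.

(** Past the place given by 1-domination, [delta] is nonincreasing, because an
    ascent there, together with the value at 1, would form a valley.  A place
    where it attains its minimum is then a place from which it is constant. *)
Lemma one_dominated_stable delta : valley_free delta -> one_dominated delta ->
  exists2 L, (0 < L)%N & forall j, (L <= j)%N ->
    delta j = delta L /\ (delta j <= delta 1)%N.
Proof.
move=> hdelta [k [k_gt0 dom]].
have [L le_kL min_L] := exists_argmin delta (ex_intro (leq k) k (leqnn k)).
exists L; first exact: leq_trans le_kL.
move=> j le_Lj; have le_kj := leq_trans le_kL le_Lj; split; last exact: dom.
apply/eqP; rewrite eqn_leq min_L // andbT leqNgt; apply/negP => lt_L.
have lt_Lj : (L < j)%N.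
  rewrite ltn_neqAle le_Lj andbT; apply: contraTneq lt_L => ->.
  by rewrite ltnn.
have L_gt1 : (1 < L)%N.
  rewrite ltn_neqAle (leq_trans k_gt0 le_kL) andbT; apply/eqP => L1.
  by move: (dom j le_kj); rewrite L1 leqNgt lt_L.
apply: (hdelta 1%N L j) => //; split=> //.
exact: leq_trans lt_L (dom _ le_kj).
Qed.

(** * A finite presentation *)
Section Presentation.
Variables (K : fieldType) (delta : nat -> nat) (hdelta : valley_free delta).
Variable (L : nat).
Hypothesis L_gt0 : (0 < L)%N.
Hypothesis delta_stable : forall j, (L <= j)%N ->
    delta j = delta L /\ (delta j <= delta 1)%N.
Local Notation A := (Cl K hdelta).
Local Notation E := (upsum K hdelta).
Implicit Types s t w : seq nat.

Definition short_cliffs := flatten [seq cliff_words delta j | j <- iota 0 L.+1].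

Lemma mem_short_cliffs s :
  (s \in short_cliffs) = (size s <= L)%N && is_cliff delta s.
Proof.
apply/flatten_mapP/andP => [[j]|[hs cs]].
  rewrite mem_iota ltnS mem_cliff_words => /andP[_ le_jL] /andP[/eqP ->].
  by split.
by exists (size s); rewrite ?mem_iota ?ltnS // mem_cliff_words eqxx.
Qed.

Local Notation n := (size short_cliffs).+1.
Local Notation free := {malg K[{fmonom 'I_n}]}.

(** There is one generator more than short cliffs, because [inord] needs a
    nonempty range; by the default value of [nth], it is a second name for the
    empty word. *)
Definition gen_word (i : 'I_n) : seq nat := nth [::] short_cliffs i.

Lemma gen_word_short i :
  (size (gen_word i) <= L)%N && is_cliff delta (gen_word i).
Proof.
rewrite -mem_short_cliffs /gen_word.
case: (ltnP i (size short_cliffs)) => hi; first exact: mem_nth.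
by rewrite nth_default // mem_short_cliffs is_cliff_nil.
Qed.

Definition word_gen s : 'I_n := inord (index s short_cliffs).

Lemma word_genK s : (size s <= L)%N -> is_cliff delta s ->
  gen_word (word_gen s) = s.
Proof.
move=> hs cs; have s_in : s \in short_cliffs by rewrite mem_short_cliffs hs.
by rewrite /gen_word /word_gen inordK ?nth_index // ltnS index_size.
Qed.

Local Notation X s := (free_gen K (word_gen s)).

Definition normal_form s : free :=
  X (take L s) * \prod_(b <- drop L s) X [:: b].

Lemma normal_form_short s : (size s <= L)%N -> normal_form s = X s.
Proof.
move=> hs; rewrite /normal_form (take_oversize hs) (drop_oversize hs).
by rewrite big_nil mulr1.
Qed.

Lemma normal_form_rcons s b : (L <= size s)%N ->
  normal_form (rcons s b) = normal_form s * X [:: b].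
Proof.
move=> hs; rewrite /normal_form -cats1 (takel_cat _ hs) drop_cat.
case: ltnP => h; first by rewrite big_cat big_seq1 mulrA.
have -> : size s = L by apply/eqP; rewrite eqn_leq hs h.
by rewrite subnn drop0 (drop_oversize h) big_nil big_seq1 mulr1.
Qed.

(** The linear section of the evaluation that sends each upper sum to its
    normal form. *)
Definition canonical_lift : A -> free :=
  linear_extension (fun u : cliff delta => normal_form u)
    \o @upsum_coord K delta hdelta.
HB.instance Definition _ := GRing.Linear.on canonical_lift.

Lemma lift_upsum s :
  canonical_lift (E s) = if is_cliff delta s then normal_form s else 0.
Proof.
case: ifPn => hs; last by rewrite (upsum_not_cliff K hdelta hs) raddf0.
rewrite /canonical_lift /= (upsum_coord_cliff K hdelta (Cliff hs)).
by rewrite linear_extensionU.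
Qed.

(** The bounds after the first [L] letters are all equal and at most [delta 1],
    so a letter admissible at one of these places is admissible at all of them
    and at the beginning of a word. *)
Lemma late_letter s b : (L <= size s)%N -> is_cliff delta (rcons s b) ->
  is_cliff delta [:: b] /\
  forall t, (L <= size t)%N -> is_cliff delta (rcons t b) = is_cliff delta t.
Proof.
move=> hs; rewrite is_cliff_rcons => /andP[_ hb]; split.
  rewrite (is_cliff_rcons delta [::] b) is_cliff_nil /=.
  by apply: leq_trans hb _; have [] := delta_stable (leqW hs).
move=> t ht; rewrite is_cliff_rcons.
have [-> _] := delta_stable (leqW ht).
by have [<- _] := delta_stable (leqW hs); rewrite hb andbT.
Qed.

Definition gen_image i : A := E (gen_word i).
Local Notation eval := (free_eval gen_image).

Lemma gen_image_word s : (size s <= L)%N -> is_cliff delta s ->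
  gen_image (word_gen s) = E s.
Proof. by move=> hs cs; rewrite /gen_image word_genK. Qed.

Lemma eval_gen s : (size s <= L)%N -> is_cliff delta s -> eval (X s) = E s.
Proof. by move=> hs cs; rewrite free_evalU gen_image_word. Qed.

Lemma eval_normal_form s : is_cliff delta s -> eval (normal_form s) = E s.
Proof.
elim/last_ind: s => [|s b IHs] hs.
  by rewrite normal_form_short // eval_gen.
have [hL|hL] := leqP (size (rcons s b)) L.
  by rewrite normal_form_short // eval_gen.
rewrite size_rcons ltnS in hL; have [hb _] := late_letter hL hs.
rewrite normal_form_rcons // rmorphM /= eval_gen // IHs.
  by rewrite upsum_mul // cats1.
by move: hs; rewrite is_cliff_rcons => /andP[].
Qed.

Lemma canonical_liftK a : eval (canonical_lift a) = a.
Proof.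
have := @eq_linear_upsum K delta hdelta A (eval \o canonical_lift) idfun.
apply=> u /=; rewrite lift_upsum (cliffP u); exact: eval_normal_form (cliffP u).
Qed.

(** The empty word is among the generators, whence the first relator. *)
Definition relators : seq free :=
  (1 - canonical_lift 1)
  :: [seq free_gen K i * free_gen K j
            - canonical_lift (gen_image i * gen_image j)
      | i <- enum 'I_n, j <- enum 'I_n].
Local Notation ideal := (in_two_sided_ideal relators).

Lemma eval_relators q : q \in relators -> eval q = 0.
Proof.
rewrite inE => /orP[/eqP ->|/allpairsP[[i j] [_ _ ->]]] /=.
  by rewrite rmorphB /= canonical_liftK rmorph1 subrr.
by rewrite rmorphB rmorphM /= canonical_liftK !free_evalU subrr.
Qed.

Lemma mul_gens_ideal i j :
  ideal (free_gen K i * free_gen K j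
           - canonical_lift (gen_image i * gen_image j)).
Proof.
apply: ideal_rel; rewrite inE; apply/orP; right; apply/allpairsP.
by exists (i, j); rewrite !mem_enum.
Qed.

(** Reduction of a normal form times a generator [x_v].  If the word is long,
    its last letter [b] is split off and [x_b * x_v] is reduced by a relator:
    either to [0], or to the generator [bv], which the induction hypothesis
    absorbs into the rest, or, when [bv] has length [L + 1], to [x_t * x_c] with
    [c] its last letter; then [x_t] is absorbed by induction and [x_c] merely
    extends a normal form that is already long. *)
Lemma normal_form_mul_gen s i : is_cliff delta s ->
  ideal (normal_form s * free_gen K i - canonical_lift (E s * gen_image i)).
Proof.
elim/last_ind: s i => [|s b IHs] i hs.
  by rewrite normal_form_short // -gen_image_word //; apply: mul_gens_ideal.
have [hL|hL] := leqP (size (rcons s b)) L.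
  rewrite (normal_form_short hL) -(gen_image_word hL hs).
  exact: mul_gens_ideal.
rewrite size_rcons ltnS in hL; have [hb _] := late_letter hL hs.
have cs : is_cliff delta s by move: hs; rewrite is_cliff_rcons => /andP[].
set v := gen_word i.
have /andP[size_v cliff_v] := gen_word_short i; rewrite -/v in size_v cliff_v.
rewrite normal_form_rcons // -mulrA.
apply: (ideal_trans (q := normal_form s * canonical_lift (E (b :: v)))).
  rewrite -mulrBr; apply: idealMl.
  have -> : E (b :: v) = gen_image (word_gen [:: b]) * gen_image i.
    rewrite (gen_image_word _ hb) //; apply/esym.
    exact: (upsum_mul K hdelta [:: b] cliff_v).
  exact: mul_gens_ideal.
have -> : E (rcons s b) * gen_image i = E s * E (b :: v).
  rewrite -cats1 -(upsum_mul K hdelta s hb) -mulrA; congr (_ * _).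
  exact: (upsum_mul K hdelta [:: b] cliff_v).
have [hbv|hbv] := boolP (is_cliff delta (b :: v)); last first.
  rewrite (upsum_not_cliff K hdelta hbv) mulr0 !raddf0 mulr0 addr0.
  exact: ideal0.
rewrite lift_upsum hbv.
have [short_bv|] := leqP (size (b :: v)) L.
  rewrite (normal_form_short short_bv) -(gen_image_word short_bv hbv).
  exact: IHs.
rewrite /= ltnS => size_v'.
have {size_v size_v'} size_v : size v = L by apply/eqP; rewrite eqn_leq size_v.
(* Here [b :: v] has length [L + 1] and is cut before its last letter. *)
rewrite lastI in hbv *; set t := belast b v in hbv *.
set c := last b v in hbv *.
have size_t : size t = L by rewrite size_belast.
have [ct cliff_rcons_c] := late_letter (eq_leq (esym size_t)) hbv.
have cliff_t : is_cliff delta t.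
  by move: hbv; rewrite is_cliff_rcons => /andP[].
have le_t : (size t <= L)%N by rewrite size_t.
rewrite normal_form_rcons ?size_t // (normal_form_short le_t) mulrA.
apply: (ideal_trans (q := canonical_lift (E (s ++ t)) * X [:: c])).
  rewrite -mulrBl; apply: idealMr.
  rewrite -(upsum_mul K hdelta s cliff_t) -(gen_image_word le_t cliff_t).
  exact: IHs.
rewrite (upsum_mul K hdelta s hbv) -rcons_cat !lift_upsum.
have long_st : (L <= size (s ++ t))%N by rewrite size_cat size_t leq_addl.
(* The bound at the place of [c] in [s ++ rcons t c] equals the one in
   [rcons t c]: this is where [delta] must be constant, and not just bounded by
   [delta 1], after [L]. *)
rewrite (cliff_rcons_c _ long_st).
case: (is_cliff delta (s ++ t)).
  by rewrite (normal_form_rcons _ long_st) subrr; apply: ideal0.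
by rewrite mul0r subr0; apply: ideal0.
Qed.

Lemma lift_mul_gen a i :
  ideal (canonical_lift a * free_gen K i - canonical_lift (a * gen_image i)).
Proof.
pose P b := ideal (canonical_lift b * free_gen K i
                     - canonical_lift (b * gen_image i)).
have PD b c : P b -> P c -> P (b + c).
  rewrite /P mulrDl !(raddfD canonical_lift) mulrDl opprD addrACA.
  exact: idealD.
have PZ k b : P b -> P (k *: b).
  rewrite /P -(scalerAl k b) !(linearZ_LR canonical_lift).
  rewrite -(scalerAl k (canonical_lift b)) -scalerBr -mulr_algl.
  exact: idealMl.
have P0 : P 0 by rewrite /P mul0r raddf0 mul0r subr0; apply: ideal0.
rewrite -/(P a) (upsum_span a); apply: (big_ind P P0 PD) => u _; apply: PZ.
rewrite /P {1}lift_upsum (cliffP u).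
exact: normal_form_mul_gen (cliffP u).
Qed.

Lemma finitely_presented_stable : finitely_presented A.
Proof.
apply: (finitely_presented_by_lift canonical_liftK eval_relators).
  by apply: ideal_rel; rewrite inE eqxx.
exact: lift_mul_gen.
Qed.

End Presentation.

Theorem lemma3p2p10 (K : fieldType) (hK : [pchar K] =i pred0)
    (delta : nat -> nat) (hdelta : valley_free delta) :
  finitely_presented (Cl K hdelta) <-> one_dominated delta.
Proof.
split=> [[n [f [f_surj _]]]|dom].
  have [N bound_N] := indecomposable_bound f_surj.
  exists N.+2; split=> // k lt_Nk; rewrite leqNgt; apply/negP => delta_k.
  have k_gt1 : (1 < k)%N by apply: leq_trans lt_Nk.
  have [w size_w ind_w] := long_indecomposable hdelta k_gt1 delta_k.
  by have := bound_N w ind_w; rewrite size_w leqNgt (ltnW lt_Nk).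
have [L L_gt0 stable] := one_dominated_stable hdelta dom.
exact: finitely_presented_stable L_gt0 stable.
Qed.
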